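(* Let $\mathcal{L}=(\eta_1,\eta_2,\ldots)$ be any Leja sequence for the closed unit disk $\overline{\mathbb{D}}$, and for $p\ge1$ and $1\le k\le 2^p-1$ let $l_k^{(2^p-1)}(z)=\prod_{j=1,\,j\ne k}^{2^p-1}\frac{z-\eta_j}{\eta_k-\eta_j}$. Then $$\lim_{p\to+\infty}\left[\frac{1}{2^p-1}\sum_{k=1}^{2^p-1}\ \sup_{z\in\overline{\mathbb{D}}}\big|l_k^{(2^p-1)}(z)\big|\right]=1.$$ More precisely, for all $p\ge2$, $$2^p-1\ <\ \sum_{k=1}^{2^p-1}\ \sup_{z\in\overline{\mathbb{D}}}\big|l_k^{(2^p-1)}(z)\big|\ \le\ \big(1+\varepsilon(1/p)\big)\,(2^p-1),$$ where $\lim_{p\to+\infty}\varepsilon(1/p)=0$.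
   Context: $\overline{\mathbb{D}}=\{z\in\mathbb{C}:|z|\le 1\}$. A Leja sequence for a compact set $K\subset\mathbb{C}$ is a sequence $(\eta_1,\eta_2,\ldots)$ of points of $K$ with $\eta_1\in\partial K$ and, for all $k\ge2$, $\sup_{z\in K}\prod_{j=1}^{k-1}|z-\eta_j|=\prod_{j=1}^{k-1}|\eta_k-\eta_j|$. *)

(* Defs.v *)
From HB Require Import structures.
From mathcomp Require Import all_boot all_order all_algebra.
From mathcomp Require Import all_classical all_reals all_analysis.
From mathcomp Require Import complex.

Set Implicit Arguments.
Unset Strict Implicit.
Unset Printing Implicit Defensive.

Import Order.TTheory GRing.Theory Num.Theory.
Import numFieldNormedType.Exports.
Import ComplexField.Normc.

Local Open Scope classical_set_scope.
Local Open Scope ring_scope.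
Local Open Scope complex_scope.

(* The usual topology of the complex plane: the one induced by the modulus
   [`|z| = (normc z)%:C], as for every numFieldType. *)
HB.instance Definition _ (R : rcfType) := NormedModule.copy R[i] R[i]^o.

Definition boundary (T : topologicalType) (K : set T) : set T :=
  closure K `\` interior K.

Definition closed_unit_disk (R : realType) : set R[i] :=
  [set z | normc z <= 1].
Arguments closed_unit_disk R : clear implicits.

(* Sequences are indexed from 0: [eta j] is the mathematical eta_(j+1).
   [sup] is the real supremum, meaningful here because [K] is intended to be
   compact. *)
Definition leja_sequence (R : realType) (K : set R[i]) (eta : nat -> R[i]) :=
  [/\ forall j, K (eta j),
      boundary K (eta 0%N) &
      forall k, (0 < k)%N ->
        sup [set \prod_(j < k) normc (z - eta j) | z in K] =
        \prod_(j < k) normc (eta k - eta j)].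

(* With 0-based indices, the n nodes are [eta 0], ..., [eta (n - 1)]. *)
Definition lagrange (R : realType) (eta : nat -> R[i]) (n k : nat) (z : R[i])
  : R[i] :=
  \prod_(j < n | j != k :> nat) ((z - eta j) / (eta k - eta j)).

Definition lagrange_disk_sup (R : realType) (eta : nat -> R[i]) (n k : nat)
  : R :=
  sup [set normc (lagrange eta n k z) | z in closed_unit_disk R].

(* Main.v *)
Require Import Defs.
From HB Require Import structures.
From mathcomp Require Import all_boot all_order all_algebra.
From mathcomp Require Import all_classical all_reals all_analysis.
From mathcomp Require Import complex.
From mathcomp Require Import zify ring lra.
Import Order.TTheory GRing.Theory Num.Theory.
Import numFieldNormedType.Exports.
Import ComplexField.Normc.
Local Open Scope classical_set_scope.
Local Open Scope ring_scope.
Local Open Scope complex_scope.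

(** Put N = 2^p and c = eta_1^N.  By induction on p, the first N points of a
    Leja sequence of the disk are the N-th roots of c: beyond them the product
    is |z^N - c| times the product over the later points, the first factor is
    maximal exactly where z^N = - c, and by induction the second one also has a
    maximizer there; so the next N points form a Leja section made of N-th roots
    of - c.

    Let w = eta_N be the only root that is not among the N - 1 nodes, and write
    Q_a(z) = (z^N - c) / (z - a).  Then N |l_k(z)| = |Q_(eta_k)(z) - Q_w(z)|,
    where |Q_a| <= min(N, 2 / |z - a|), and hence
    |l_k| <= 1 + 4 / (N |eta_k - w|) on the disk.  Pairing the square roots r and
    - r of each u gives sum_k 1 / |eta_k - w| <= 3^p, so the sum of the suprema
    is at most N - 1 + 4 (3/2)^p.  For the strict lower bound, l_k exceeds 1 in
    modulus halfway along the arc from w to the neighbouring root eta_k. *)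

(** * Modulus of complex numbers *)

Lemma normc_ge0 {R : rcfType} (x : R[i]) : 0 <= normc x.
Proof. by case: x => a b; exact: sqrtr_ge0. Qed.

Lemma normc_eq0 {R : rcfType} (x : R[i]) : (normc x == 0) = (x == 0).
Proof.
by apply/eqP/eqP => [/eq0_normc|->] //; exact: normc0.
Qed.

(* [normc0] and [normc1] are about the constants [0%C] and [1%C]:
   they do not rewrite the ring constants. *)
Lemma normc_zero {R : rcfType} : normc (0 : R[i]) = 0.
Proof. exact: normc0. Qed.

Lemma normc_one {R : rcfType} : normc (1 : R[i]) = 1.
Proof. exact: normc1. Qed.

Lemma normc_opp1 {R : rcfType} : normc (- 1 : R[i]) = 1.
Proof. by rewrite normcN normc_one. Qed.

Lemma normcX {R : rcfType} (x : R[i]) n : normc (x ^+ n) = normc x ^+ n.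
Proof. by elim: n => [|n IH]; rewrite ?normc_one // !exprS normcM IH. Qed.

Lemma normc_prod {R : rcfType} (I : Type) (r : seq I) (P : pred I)
    (F : I -> R[i]) :
  normc (\prod_(i <- r | P i) F i) = \prod_(i <- r | P i) normc (F i).
Proof. by apply: (big_morph _ (@normcM R)); exact: normc1. Qed.

Lemma ler_normc_sum {R : rcfType} (I : Type) (r : seq I) (P : pred I)
    (F : I -> R[i]) :
  normc (\sum_(i <- r | P i) F i) <= \sum_(i <- r | P i) normc (F i).
Proof.
elim/big_rec2: _ => [|i y x _ le_xy].
  by rewrite normc_zero.
by apply: le_trans (le_normcD _ _) _; rewrite lerD2l.
Qed.

Lemma distcC {R : rcfType} (x y : R[i]) : normc (x - y) = normc (y - x).
Proof. by rewrite -opprB normcN. Qed.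

Lemma ler_distcD {R : rcfType} (z x y : R[i]) :
  normc (x - y) <= normc (x - z) + normc (z - y).
Proof.
have -> : x - y = (x - z) + (z - y) by ring.
exact: le_normcD.
Qed.

Lemma normc_unity {R : rcfType} n (x c : R[i]) :
  (0 < n)%N -> normc c = 1 -> x ^+ n = c -> normc x = 1.
Proof.
move=> n_gt0 c1 xc; apply/eqP; rewrite -(@pexpr_eq1 _ _ n) ?normc_ge0 //.
by rewrite -normcX xc c1.
Qed.

Lemma nrootc_ex {R : rcfType} n (c : R[i]) :
  (0 < n)%N -> exists z : R[i], z ^+ n = c.
Proof.
move=> n_gt0; have /closed_rootP[z /rootP z0] : size ('X^n - c%:P) != 1%N.
  by rewrite size_XnsubC // eqSS -lt0n.
by exists z; move: z0; rewrite !hornerE => /eqP; rewrite subr_eq0 => /eqP.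
Qed.

(** * Finite Leja sections of the disk and their binary structure *)

(* The Leja conditions on the first [n] points only, with the supremum replaced
   by an upper bound that is attained. *)
Definition leja_prefix {R : rcfType} (e : nat -> R[i]) (n : nat) : Prop :=
  forall k, (k < n)%N ->
    [/\ normc (e k) <= 1, k = 0%N -> normc (e k) = 1 &
        forall z, normc z <= 1 ->
          \prod_(j < k) normc (z - e j) <= \prod_(j < k) normc (e k - e j)].

(** What a point must satisfy to be appended after the first n. The empty product selects nothing,
    so the clause for n = 0 puts the first point on the circle. *)
Definition leja_maximizer {R : rcfType} (e : nat -> R[i]) (n : nat) (x : R[i])
  : Prop :=
  [/\ normc x <= 1, n = 0%N -> normc x = 1 &
      forall z, normc z <= 1 ->
        \prod_(j < n) normc (z - e j) <= \prod_(j < n) normc (x - e j)].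

Lemma leja_prefixW {R : rcfType} (e : nat -> R[i]) m n :
  (m <= n)%N -> leja_prefix e n -> leja_prefix e m.
Proof. by move=> le_mn he k lt_km; apply: he; apply: leq_trans le_mn. Qed.

Lemma leja_prefix_eq {R : rcfType} (e f : nat -> R[i]) n :
  (forall k, (k < n)%N -> e k = f k) -> leja_prefix e n -> leja_prefix f n.
Proof.
move=> ef he k lt_kn; have efj (j : 'I_k) : f j = e j.
  by rewrite ef // (ltn_trans (ltn_ord j)).
have [h1 h2 h3] := he k lt_kn; rewrite -ef //; split=> // z z1.
under eq_bigr do rewrite efj; under [leRHS]eq_bigr do rewrite efj.
exact: h3.
Qed.

Lemma leja_prefixS {R : rcfType} (e : nat -> R[i]) n :
  leja_prefix e n -> leja_maximizer e n (e n) -> leja_prefix e n.+1.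
Proof.
by move=> he hn k; rewrite ltnS leq_eqVlt => /predU1P[->//|]; apply: he.
Qed.

(* [leja_extends] and [leja_binary] are proved by simultaneous induction on [p]. *)
Definition leja_extends (R : rcfType) (p : nat) : Prop :=
  forall (e : nat -> R[i]) n, (n < 2 ^ p)%N -> leja_prefix e n ->
    exists x, leja_maximizer e n x.

Definition leja_binary (R : rcfType) (p : nat) : Prop :=
  forall e : nat -> R[i], leja_prefix e (2 ^ p) ->
    \prod_(j < 2 ^ p) ('X - (e j)%:P) = 'X^(2 ^ p) - (e 0%N ^+ (2 ^ p))%:P.

(** Appending maximizers one at a time yields a section of full length 2^p, to which [leja_binary]
    applies. *)
Lemma leja_extend_to {R : rcfType} p (e : nat -> R[i]) n :
  leja_extends R p -> (n <= 2 ^ p)%N -> leja_prefix e n ->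
  exists2 f, (forall k, (k < n)%N -> f k = e k) & leja_prefix f (2 ^ p).
Proof.
move=> ext_p le_n he; have [d Dd] : exists d, (2 ^ p = n + d)%N.
  by exists (2 ^ p - n)%N; rewrite subnKC.
elim: d => [|d IH] in e n le_n he Dd *; first by exists e; rewrite // Dd addn0.
have lt_n : (n < 2 ^ p)%N by rewrite Dd -addSnnS leq_addr.
have [x hx] := ext_p e n lt_n he.
pose g k := if k == n then x else e k.
have ge k : (k < n)%N -> g k = e k by rewrite /g => /ltn_eqF->.
have hg : leja_prefix g n.+1.
  apply: leja_prefixS.
    by apply: leja_prefix_eq he => k /ge.
  have gj (j : 'I_n) : g j = e j by exact: ge.
  have -> : g n = x by rewrite /g eqxx.
  case: hx => h1 h2 h3; split=> // z z1.
  under eq_bigr do rewrite gj; under [leRHS]eq_bigr do rewrite gj.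
  exact: h3.
have [|f fg hf] := IH g n.+1 lt_n hg; first by rewrite Dd addnS.
by exists f => // k lt_kn; rewrite fg ?ge // ltnW.
Qed.

Lemma leja_binary_root {R : rcfType} p (e : nat -> R[i]) k :
  leja_binary R p -> leja_prefix e (2 ^ p) -> (k < 2 ^ p)%N ->
  e k ^+ (2 ^ p) = e 0%N ^+ (2 ^ p).
Proof.
move=> bin_p he lt_k; have := congr1 (fun q => q.[e k]) (bin_p e he).
rewrite horner_prod (bigD1 (Ordinal lt_k)) //= !hornerE subrr mul0r.
by move/esym/eqP; rewrite subr_eq0 => /eqP.
Qed.

Lemma leja_binary_norm {R : rcfType} p (e : nat -> R[i]) z :
  leja_binary R p -> leja_prefix e (2 ^ p) ->
  \prod_(j < 2 ^ p) normc (z - e j) = normc (z ^+ (2 ^ p) - e 0%N ^+ (2 ^ p)).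
Proof.
move=> bin_p he; have := congr1 (fun q => q.[z]) (bin_p e he).
rewrite horner_prod !hornerE => <-; rewrite normc_prod.
by apply: eq_bigr => j _; rewrite !hornerE.
Qed.

(* A maximizer of the tail can be taken among the roots of
   [z ^ 2^p = - e 0 ^ 2^p]; hence it also maximizes the modulus of
   [z ^ 2^p - e 0 ^ 2^p], the contribution of the first [2^p] points. *)
Lemma leja_tail_maximizer {R : rcfType} p (e : nat -> R[i]) m c :
  leja_extends R p -> leja_binary R p -> (m < 2 ^ p)%N ->
  normc c = 1 -> leja_prefix e m ->
  (forall k, (k < m)%N -> e k ^+ (2 ^ p) = c) ->
  exists2 x, x ^+ (2 ^ p) = c & leja_maximizer e m x.
Proof.
move=> ext_p bin_p lt_m c1 he ec; have N_gt0 : (0 < 2 ^ p)%N by rewrite expn_gt0.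
have [m0|m_gt0] := posnP m.
  have [x xc] := @nrootc_ex R (2 ^ p) c N_gt0.
  have x1 := normc_unity _ _ _ N_gt0 c1 xc.
  by exists x => //; split; rewrite ?x1 // m0 => z _; rewrite !big_ord0.
(* In a completed section the point of index m is a maximizer, and [leja_binary] makes it a root of
   the same constant as the point of index 0, which is c because m > 0. *)
have [f fe hf] := leja_extend_to p e m ext_p (ltnW lt_m) he.
have fc : f m ^+ (2 ^ p) = c.
  by rewrite (leja_binary_root p f m) // fe // ec.
exists (f m) => //; have [h1 h2 h3] := hf m lt_m; split=> // z z1.
have fj (j : 'I_m) : e j = f j by rewrite fe.
under eq_bigr do rewrite fj; under [leRHS]eq_bigr do rewrite fj.
exact: h3.
Qed.

Lemma prod_normc_add {R : rcfType} p (e : nat -> R[i]) m z :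
  leja_binary R p -> leja_prefix e (2 ^ p) ->
  \prod_(j < 2 ^ p + m) normc (z - e j) =
  normc (z ^+ (2 ^ p) - e 0%N ^+ (2 ^ p)) *
    \prod_(j < m) normc (z - e (2 ^ p + j)%N).
Proof. by move=> ? ?; rewrite big_split_ord /= leja_binary_norm. Qed.

Lemma normcB_le2 {R : rcfType} (x y : R[i]) :
  normc x <= 1 -> normc y <= 1 -> normc (x - y) <= 2.
Proof.
move=> x1 y1; apply: le_trans (le_normcD _ _) _.
by rewrite normcN -[2]/(1 + 1) lerD.
Qed.

Lemma normcX_le1 {R : rcfType} (x : R[i]) n : normc x <= 1 -> normc (x ^+ n) <= 1.
Proof. by move=> x1; rewrite normcX exprn_ile1 // normc_ge0. Qed.

(** Equality case of the triangle inequality: |x + c|^2 = 2|x|^2 + 2|c|^2 - |x - c|^2 is at most 2 +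
    2 - 4 = 0. *)
Lemma normcB_ge2 {R : rcfType} (x c : R[i]) :
  normc x <= 1 -> normc c = 1 -> 2 <= normc (x - c) -> x = - c.
Proof.
case: x => a b; case: c => u v; simpc => /=.
set s := a ^+ 2 + b ^+ 2; set t := u ^+ 2 + v ^+ 2.
move=> s1 t1 h.
have s0 : 0 <= s by rewrite addr_ge0 ?sqr_ge0.
have t0 : 0 <= t by rewrite addr_ge0 ?sqr_ge0.
have s1' : s <= 1 by rewrite -(sqr_sqrtr s0) expr_le1 ?sqrtr_ge0.
have t1' : t = 1 by rewrite -(sqr_sqrtr t0) t1 expr1n.
have w0 : 0 <= (a - u) ^+ 2 + (b - v) ^+ 2 by rewrite addr_ge0 ?sqr_ge0.
have h' : 4 <= (a - u) ^+ 2 + (b - v) ^+ 2.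
  rewrite -(sqr_sqrtr w0); have -> : 4 = 2 ^+ 2 :> R by ring.
  by rewrite ler_pXn2r ?nnegrE ?sqrtr_ge0.
have : (a + u) ^+ 2 + (b + v) ^+ 2 = 0.
  apply/eqP; rewrite eq_le addr_ge0 ?sqr_ge0 // andbT.
  have -> : (a + u) ^+ 2 + (b + v) ^+ 2 =
    2 * s + 2 * t - ((a - u) ^+ 2 + (b - v) ^+ 2) by rewrite /s /t; ring.
  lra.
move/eqP; rewrite paddr_eq0 ?sqr_ge0 // !sqrf_eq0 !addr_eq0.
by case/andP => /eqP-> /eqP->.
Qed.

Lemma leja_tail {R : rcfType} p (e : nat -> R[i]) m :
  leja_extends R p -> leja_binary R p -> (m <= 2 ^ p)%N ->
  leja_prefix e (2 ^ p + m) ->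
  leja_prefix (fun j => e (2 ^ p + j)%N) m /\
  (forall k, (k < m)%N -> e (2 ^ p + k)%N ^+ (2 ^ p) = - e 0%N ^+ (2 ^ p)).
Proof.
move=> ext_p bin_p; set N := (2 ^ p)%N => + he.
have N_gt0 : (0 < N)%N by rewrite expn_gt0.
have heN : leja_prefix e N by apply: leja_prefixW he; rewrite leq_addr.
have [_ /(_ erefl) e0 _] := heN 0%N N_gt0.
have c1 : normc (- e 0%N ^+ N) = 1 by rewrite normcN normcX e0 expr1n.
elim: m => [|m IH] in he * => le_m; first by [].
have [|hm em] := IH _ (ltnW le_m).
  by apply: leja_prefixW he; rewrite addnS.
have [x xc [x1 x2 x3]] :=
  leja_tail_maximizer p _ m _ ext_p bin_p le_m c1 hm em.
have [|b1 b2 b3] := he (N + m)%N; first by rewrite addnS.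
set y := e (N + m)%N in b1 b2 b3.
have := b3 x x1; rewrite !prod_normc_add // -/N xc.
have -> : normc (- e 0%N ^+ N - e 0%N ^+ N) = 2.
  have -> : - e 0%N ^+ N - e 0%N ^+ N = (- e 0%N ^+ N) *+ 2 by ring.
  by rewrite normcMn c1.
set M := \prod_(j < m) _; set My := \prod_(j < m) _ => hxy.
(* At z = 0 the tail product is 1, its points being unimodular; M > 0 can then be cancelled
   below. *)
have M1 : 1 <= M.
  apply: le_trans (x3 0 _); last by rewrite normc_zero.
  rewrite big1 // => j _.
  rewrite sub0r normcN; apply: normc_unity N_gt0 c1 _.
  by rewrite em.
have yM : My <= M := x3 y b1.
have y2 : normc (y ^+ N - e 0%N ^+ N) <= 2.
  by rewrite normcB_le2 ?normcX_le1 // e0.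
have My0 : 0 <= My by apply: prodr_ge0 => j _; exact: normc_ge0.
(* With d = |y^N - e_0^N|, [hxy] gives 2 M <= d My <= d M, so d >= 2. Conversely d <= 2 then forces
   M <= My. *)
have yc : y ^+ N = - e 0%N ^+ N.
  apply: normcB_ge2; rewrite ?normcX_le1 // ?normcX ?e0 ?expr1n //.
  move: (normc_ge0 (y ^+ N - e 0%N ^+ N)) => d0; nra.
have MyM : M <= My by nra.
split=> [|k]; last first.
  by rewrite ltnS leq_eqVlt => /predU1P[->//|]; apply: em.
apply: leja_prefixS => //; rewrite -/y; split=> //.
  by move=> _; exact: normc_unity N_gt0 c1 yc.
by move=> z z1; apply: le_trans (x3 z z1) MyM.
Qed.

Lemma leja_structure {R : rcfType} p : leja_extends R p /\ leja_binary R p.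
Proof.
elim: p => [|p [ext_p bin_p]].
  split=> [e n|e _]; last by rewrite big_ord1 !expr1.
  rewrite ltnS leqn0 => /eqP-> _; exists 1.
  by split; rewrite ?normc_one // => z _; rewrite !big_ord0.
have D : (2 ^ p.+1 = 2 ^ p + 2 ^ p)%N by rewrite expnS mul2n addnn.
have N_gt0 : (0 < 2 ^ p)%N by rewrite expn_gt0.
split=> [e n|e]; rewrite D.
  have [lt_n|le_n] := ltnP n (2 ^ p); first by move=> _; exact: ext_p.
  rewrite -(subnKC le_n) ltn_add2l; set m := (n - 2 ^ p)%N => lt_m he.
  have [hm em] := leja_tail p e m ext_p bin_p (ltnW lt_m) he.
  have heN : leja_prefix e (2 ^ p) by apply: leja_prefixW he; rewrite leq_addr.
  have [_ /(_ erefl) e0 _] := heN 0%N N_gt0.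
  have c1 : normc (- e 0%N ^+ (2 ^ p)) = 1 by rewrite normcN normcX e0 expr1n.
  have [x xc [x1 x2 x3]] :=
    leja_tail_maximizer p _ m _ ext_p bin_p lt_m c1 hm em.
  exists x; split=> // [|z z1]; first by move=> ?; lia.
  (* Both factors are maximal at x: the first one equals 2 there, the second one is maximal by the
     choice of x. *)
  rewrite !prod_normc_add //; apply: ler_pM; rewrite ?normc_ge0 ?x3 //.
    by apply: prodr_ge0 => j _; exact: normc_ge0.
  have -> : x ^+ (2 ^ p) - e 0%N ^+ (2 ^ p) = (- e 0%N ^+ (2 ^ p)) *+ 2.
    by rewrite xc; ring.
  by rewrite normcMn c1 normcB_le2 ?normcX_le1 // e0.
move=> he; have [hm em] := leja_tail p e _ ext_p bin_p (leqnn _) he.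
have heN : leja_prefix e (2 ^ p) by apply: leja_prefixW he; rewrite leq_addr.
(* The tail is itself a section of N = 2^p points, with constant - c for c = e_0^N, so the product
   is (X^N - c)(X^N + c). *)
rewrite big_split_ord /= bin_p // (bin_p (fun j => e (2 ^ p + j)%N)) //.
rewrite em // !exprD polyCN polyCM; ring.
Qed.

(** * Lagrange polynomials on all the N-th roots of c but one *)

(** The quotient (z^N - a^N) / (z - a), expanded so that it keeps its meaning at z = a. *)
Definition geom_quotient {R : rcfType} (N : nat) (a z : R[i]) : R[i] :=
  \sum_(i < N) z ^+ (N.-1 - i) * a ^+ i.

Lemma geom_quotientE {R : rcfType} N (a z : R[i]) :
  (z - a) * geom_quotient N a z = z ^+ N - a ^+ N.
Proof. by rewrite subrXX. Qed.

Lemma geom_quotient_le {R : rcfType} N (a z : R[i]) :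
  normc a <= 1 -> normc z <= 1 -> normc (geom_quotient N a z) <= N%:R.
Proof.
move=> a1 z1; apply: le_trans (ler_normc_sum _ _ _ _) _.
rewrite -[leRHS]mulr_natr mul1r -[X in X%:R](card_ord N) -sumr_const.
apply: ler_sum => i _; rewrite normcM -[1]mul1r.
by rewrite ler_pM ?normc_ge0 ?normcX_le1.
Qed.

Lemma geom_quotient_mul_le2 {R : rcfType} N (a z : R[i]) :
  normc a <= 1 -> normc z <= 1 ->
  normc (z - a) * normc (geom_quotient N a z) <= 2.
Proof.
by move=> a1 z1; rewrite -normcM geom_quotientE normcB_le2 ?normcX_le1.
Qed.

Lemma normc_geom_quotient_diag {R : rcfType} N (a : R[i]) :
  normc a = 1 -> normc (geom_quotient N.+1 a a) = N.+1%:R.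
Proof.
move=> a1; rewrite /geom_quotient (eq_bigr (fun=> a ^+ N)); last first.
  by move=> i _; rewrite -exprD subnK // -ltnS.
by rewrite sumr_const card_ord normcMn normcX a1 expr1n.
Qed.

Section UnityNodes.

Context {R : realType} (n : nat) (e : nat -> R[i]) (c : R[i]).
Hypothesis c1 : normc c = 1.
Hypothesis He : \prod_(j < n.+1) ('X - (e j)%:P) = 'X^(n.+1) - c%:P.

Let N := n.+1.
Let w := e n.

Lemma unity_node_pow k : (k < N)%N -> e k ^+ N = c.
Proof.
move=> lt_k; have := congr1 (fun q => q.[e k]) He.
rewrite horner_prod (bigD1 (Ordinal lt_k)) //= !hornerE subrr mul0r.
by move/esym/eqP; rewrite subr_eq0 => /eqP.
Qed.

Lemma unity_node_norm k : (k < N)%N -> normc (e k) = 1.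
Proof. by move=> lt_k; apply: normc_unity (unity_node_pow k lt_k). Qed.

Lemma unity_node_ex x : x ^+ N = c -> exists2 k, (k < N)%N & x = e k.
Proof.
move=> xc; have := congr1 (fun q => q.[x]) He.
rewrite horner_prod !hornerE xc subrr => /eqP; rewrite prodf_seq_eq0.
case/hasP => k _ /=; rewrite !hornerE subr_eq0 => /eqP ->.
by exists (k : nat).
Qed.

Lemma unity_prod_neq k z : (k < N)%N ->
  \prod_(j < N | j != k :> nat) (z - e j) = geom_quotient N (e k) z.
Proof.
move=> lt_k.
(* Proved for polynomials, where X - e_k can be cancelled; the number z - e_k may vanish. *)
have H : \prod_(j < N | j != k :> nat) ('X - (e j)%:P) =
    \sum_(i < N) 'X ^+ (N.-1 - i) * (e k)%:P ^+ i.
  have ek0 : 'X - (e k)%:P != 0 by rewrite polyXsubC_eq0.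
  apply: (mulfI ek0); rewrite -subrXX -polyC_exp unity_node_pow // -He.
  by rewrite [RHS](bigD1 (Ordinal lt_k)).
have := congr1 (fun q => q.[z]) H; rewrite horner_prod horner_sum => E.
rewrite /geom_quotient; under eq_bigr do rewrite -hornerXsubC.
by rewrite E; apply: eq_bigr => i _; rewrite -polyC_exp !hornerE.
Qed.

(** The numerator of l_k. Multiplying it by z - w or by z - e_k restores one missing root and leaves
    the other out. *)
Let A k z := \prod_(j < n | j != k :> nat) (z - e j).

Let mul_last k z : (k < n)%N -> A k z * (z - w) = geom_quotient N (e k) z.
Proof.
move=> lt_k; rewrite -unity_prod_neq ?ltnS 1?ltnW //.
by rewrite [RHS]big_mkcond big_ord_recr /= -big_mkcond /= gtn_eqF.
Qed.

Let mul_node k z : (k < n)%N -> A k z * (z - e k) = geom_quotient N w z.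
Proof.
move=> lt_k; rewrite -unity_prod_neq //.
rewrite [RHS]big_mkcond big_ord_recr /= eqxx mulr1.
rewrite mulrC [RHS](bigD1 (Ordinal lt_k)) //= ltn_eqF //=; congr (_ * _).
by apply: eq_bigr => j _; rewrite ltn_eqF.
Qed.

Let normc_A k : (k < n)%N -> normc (A k (e k)) * normc (e k - w) = N%:R.
Proof.
move=> lt_k; rewrite -normcM mul_last // normc_geom_quotient_diag //.
by rewrite unity_node_norm // ltnS ltnW.
Qed.

(** Neither factor on the left of [normc_A] can vanish, since their product is N. *)
Lemma unity_node_neq k : (k < n)%N -> e k != w.
Proof.
move=> lt_k; rewrite -subr_eq0 -normc_eq0; apply/eqP => d0.
by have /esym/eqP := normc_A k lt_k; rewrite d0 mulr0 pnatr_eq0.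
Qed.

Let A_neq0 k : (k < n)%N -> normc (A k (e k)) != 0.
Proof.
move=> lt_k; apply/eqP => A0.
by have /esym/eqP := normc_A k lt_k; rewrite A0 mul0r pnatr_eq0.
Qed.

(** Kept free of division by z - w, so that it also holds at w. *)
Lemma lagrange_norm_last k z : (k < n)%N ->
  N%:R * normc (Defs.lagrange e n k z) * normc (z - w) =
  normc (e k - w) * normc (geom_quotient N (e k) z).
Proof.
move=> lt_k; rewrite /Defs.lagrange prodf_div -/(A k z) -/(A k (e k)).
have A0 := A_neq0 k lt_k.
by rewrite -mul_last // -(normc_A k lt_k) !normcM normcV; field.
Qed.

(** Subtracting [mul_node] from [mul_last] leaves A_k(z) (e_k - w), and |e_k - w| is N /
    |A_k(e_k)|. *)
Lemma lagrange_norm k z : (k < n)%N ->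
  N%:R * normc (Defs.lagrange e n k z) =
  normc (geom_quotient N (e k) z - geom_quotient N w z).
Proof.
move=> lt_k; rewrite /Defs.lagrange prodf_div -/(A k z) -/(A k (e k)).
have A0 := A_neq0 k lt_k.
rewrite -mul_last // -(mul_node k) // -mulrBr -(normc_A k lt_k).
have -> : z - w - (z - e k) = e k - w by ring.
by rewrite !normcM normcV; field.
Qed.

(* [z] is at distance at least [|e k - w| / 2] from [w] or from [e k], so that
   one of the two quotients is at most [4 / |e k - w|], the other at most [N]. *)
Lemma lagrange_norm_le k z : (k < n)%N -> normc z <= 1 ->
  normc (Defs.lagrange e n k z) <= 1 + 4 / (N%:R * normc (e k - w)).
Proof.
move=> lt_k z1.
have N0 : 0 < N%:R :> R by rewrite ltr0n.
have d0 : 0 < normc (e k - w).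
  by rewrite lt_def normc_ge0 normc_eq0 subr_eq0 unity_node_neq.
have ek1 : normc (e k) <= 1 by rewrite unity_node_norm // ltnS ltnW.
have w1 : normc w <= 1 by rewrite unity_node_norm.
have tri := ler_distcD z (e k) w; rewrite (distcC (e k) z) in tri.
have := le_normcD (geom_quotient N (e k) z) (- geom_quotient N w z).
rewrite normcN -lagrange_norm // => H.
have B1 := geom_quotient_mul_le2 N _ _ ek1 z1.
have B2 := geom_quotient_mul_le2 N _ _ w1 z1.
have C1 := geom_quotient_le N _ _ ek1 z1.
have C2 := geom_quotient_le N _ _ w1 z1.
rewrite -(ler_pM2l N0) mulrDr mulr1.
have -> : N%:R * (4 / (N%:R * normc (e k - w))) = 4 / normc (e k - w).
  by field; rewrite !gt_eqF.
apply: le_trans H _.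
have P1 := normc_ge0 (geom_quotient N (e k) z).
have P2 := normc_ge0 (geom_quotient N w z).
set d := normc (e k - w) in d0 tri *.
have [lt|ge] := ltP (normc (z - e k)) (d / 2).
  rewrite lerD // ler_pdivlMr //.
  have : d / 2 <= normc (z - w) by lra.
  by move/(ler_wpM2r P2); lra.
rewrite addrC lerD // ler_pdivlMr //.
by move: ge => /(ler_wpM2r P1); lra.
Qed.

Lemma lagrange_norm_node k : (k < n)%N -> normc (Defs.lagrange e n k (e k)) = 1.
Proof.
move=> lt_k; have d0 : normc (e k - w) != 0.
  by rewrite normc_eq0 subr_eq0 unity_node_neq.
have := lagrange_norm_last k (e k) lt_k.
rewrite normc_geom_quotient_diag ?unity_node_norm ?ltnS 1?ltnW // mulrC.
move/(mulfI d0)/(canRL (mulKf _)) => -> ; first by rewrite mulVf ?pnatr_eq0.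
by rewrite pnatr_eq0.
Qed.

End UnityNodes.

(** * Sums of inverse distances between roots *)

Lemma parallelogram {R : rcfType} (x y : R[i]) :
  normc (x - y) ^+ 2 + normc (x + y) ^+ 2 = 2 * normc x ^+ 2 + 2 * normc y ^+ 2.
Proof.
case: x => a b; case: y => c d; simpc => /=.
by rewrite !sqr_sqrtr ?addr_ge0 ?sqr_ge0 //; ring.
Qed.

(* [invr0] makes the first summand vanish at [a = w], where the indicator takes
   over; this value 1 at [w] is what makes [inv_dist_sqrt] hold there too. *)
Definition inv_dist {R : rcfType} (w a : R[i]) : R :=
  (normc (a - w))^-1 + (a == w)%:R.

Lemma inv_dist_refl {R : rcfType} (w : R[i]) : inv_dist w w = 1.
Proof.
by rewrite /inv_dist subrr normc_zero invr0 eqxx add0r.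
Qed.

Lemma inv_dist_opp {R : rcfType} (w : R[i]) :
  normc w = 1 -> inv_dist w (- w) = 2^-1.
Proof.
move=> w1; have w0 : w != 0 by rewrite -normc_eq0 w1 oner_eq0.
rewrite /inv_dist -opprD normcN -mulr2n normcMn w1.
by rewrite -subr_eq0 -opprD oppr_eq0 -mulr2n mulrn_eq0 (negPf w0) addr0.
Qed.

(** With x = |r - w| and y = |r + w|, the sum is (x + y) / |r^2 - w^2|, and (x + y)^2 <= 2 (x^2 +
    y^2) = 8 < 9. If r is w or - w, it is 1 + 1/2. *)
Lemma inv_dist_sqrt {R : rcfType} (w r : R[i]) : normc w = 1 -> normc r = 1 ->
  inv_dist w r + inv_dist w (- r) <= 3 * inv_dist (w ^+ 2) (r ^+ 2).
Proof.
move=> w1 r1; have [/eqP|ne] := boolP (r ^+ 2 == w ^+ 2).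
  move=> /eqP; rewrite eqf_sqr => /orP[] /eqP->; rewrite ?sqrrN ?opprK;
  by rewrite !inv_dist_refl inv_dist_opp //; lra.
rewrite /inv_dist (negPf ne); move: ne; rewrite eqf_sqr negb_or => /andP[n1 n2].
rewrite (negPf n1) eqr_oppLR (negPf n2) !addr0 -opprD normcN subr_sqr normcM.
have := parallelogram r w; rewrite r1 w1.
have : 0 < normc (r - w) by rewrite lt_def normc_ge0 normc_eq0 subr_eq0 n1.
have : 0 < normc (r + w) by rewrite lt_def normc_ge0 normc_eq0 addr_eq0 n2.
move: (normc (r - w)) (normc (r + w)) => x y y0 x0 xy.
have -> : x^-1 + y^-1 = (x + y) * (x * y)^-1 by field; rewrite !gt_eqF.
rewrite ler_pM2r ?invr_gt0 ?mulr_gt0 //.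
by have := sqr_ge0 (x - y); move: xy; rewrite expr1n; nra.
Qed.

(** Squaring sends the roots for p + 1 two to one onto those for p, with w^2 in place of w, and each
    pair costs a factor 3. Any base below 4 would suffice for the limit. *)
Lemma sum_inv_dist_le {R : rcfType} p (s : seq R[i]) w : normc w = 1 ->
  \prod_(a <- s) ('X - a%:P) = 'X^(2 ^ p) - (w ^+ (2 ^ p))%:P ->
  \sum_(a <- s) inv_dist w a <= 3 ^+ p.
Proof.
elim: p s w => [|p IH] s w w1 Hs.
  have /prod_XsubC_eq sw : \prod_(a <- s) ('X - a%:P) =
    \prod_(a <- [:: w]) ('X - a%:P) by rewrite Hs big_seq1.
  by rewrite (perm_big _ sw) big_seq1 inv_dist_refl.
set N := (2 ^ p)%N in IH; have N_gt0 : (0 < N)%N by rewrite expn_gt0.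
have [t] := closed_field_poly_normal ('X^N - ((w ^+ 2) ^+ N)%:P).
rewrite lead_coefXnsubC // scale1r => Ht.
have t1 u : u \in t -> normc (sqrtc u) = 1.
  move=> ut; apply: (normc_unity (2 * N)%N _ ((w ^+ 2) ^+ N)).
  - by rewrite muln_gt0.
  - by rewrite !normcX w1 !expr1n.
  rewrite exprM sqr_sqrtc; have := congr1 (fun q => q.[u]) Ht.
  rewrite horner_prod (big_rem u) //= !hornerE subrr mul0r.
  by move/eqP; rewrite subr_eq0 => /eqP.
have /prod_XsubC_eq st : \prod_(a <- s) ('X - a%:P) =
    \prod_(a <- map (@sqrtc R) t ++ map (fun u => - sqrtc u) t) ('X - a%:P).
  rewrite Hs big_cat !big_map /= -big_split /=.
  (* Each pair of factors is X^2 - u, so the whole product is that of t composed with X^2. *)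
  rewrite (eq_bigr (fun u => ('X - u%:P) \Po 'X^2)); last first.
    move=> u _; rewrite comp_polyB comp_polyX comp_polyC -{3}(sqr_sqrtc u).
    by rewrite polyCN polyC_exp; ring.
  rewrite -(rmorph_prod (comp_poly 'X^2)) -Ht /= comp_polyB comp_polyC.
  by rewrite expnS comp_Xn_poly -!exprM.
rewrite (perm_big _ st) big_cat !big_map /=.
have -> : \sum_(u <- t) inv_dist w (sqrtc u) +
    \sum_(u <- t) inv_dist w (- sqrtc u) =
    \sum_(u <- t) (inv_dist w (sqrtc u) + inv_dist w (- sqrtc u)).
  by rewrite [RHS]big_split.
rewrite big_seq exprS; apply: le_trans (ler_wpM2l _ (IH t (w ^+ 2) _ (esym Ht))) => //.
  rewrite big_seq mulr_sumr ler_sum // => u ut.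
  by rewrite -{3}(sqr_sqrtc u) inv_dist_sqrt // t1.
by rewrite normcX w1 expr1n.
Qed.

(** * A root of - 1 near 1 and the strict lower bound *)

(* [y = exp (i pi / 2 ^ p)] would do, as [2 ^ p tan (pi / 2 ^ p.+1)] decreases
   from 2 at [p = 1]; the step halves the angle. *)
Lemma root_opp1_near1_half {R : rcfType} M (y : R[i]) :
  (0 < M)%N -> y ^+ M = - 1 -> M%:R * normc (y - 1) <= 2 * normc (y + 1) ->
  exists2 x : R[i], x ^+ (2 * M) = - 1 &
    (2 * M)%N%:R * normc (x - 1) < 2 * normc (x + 1).
Proof.
move=> M_gt0 yM hy.
(* The root in the right half-plane is the one with |x^2 + 1| = 2 Re x. *)
have [x xy x0] : exists2 x : R[i], x ^+ 2 = y & 0 <= complex.Re x.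
  have [h|h] := leP 0 (complex.Re (sqrtc y)); first by exists (sqrtc y); rewrite ?sqr_sqrtc.
  exists (- sqrtc y); first by rewrite sqrrN sqr_sqrtc.
  by move: h; case: (sqrtc y) => a b /= h; rewrite oppr_ge0 ltW.
have xM : x ^+ (2 * M) = - 1 by rewrite exprM xy.
have x1 : normc x = 1.
  by apply: normc_unity normc_opp1 xM; rewrite muln_gt0.
have xn1 : x != 1.
  apply/eqP => x1'; move: xM; rewrite x1' expr1n => /eqP.
  by rewrite -subr_eq0 opprK -mulr2n pnatr_eq0.
exists x => //; move: hy; rewrite -xy.
have -> : x ^+ 2 - 1 = (x - 1) * (x + 1) by ring.
rewrite normcM.
have s1 : complex.Re x ^+ 2 + complex.Im x ^+ 2 = 1.
  case: (x) x1 => a b /= ab1.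
  by rewrite -(@sqr_sqrtr _ (_ + _)) ?ab1 ?expr1n // addr_ge0 ?sqr_ge0.
have -> : normc (x ^+ 2 + 1) = 2 * complex.Re x.
  have -> : x ^+ 2 + 1 = (2 * complex.Re x)%:C * x.
    case: (x) s1 => a b /= s1; apply/eqP; rewrite expr2 eq_complex /=.
    by apply/andP; split; apply/eqP; lra.
  rewrite normcM x1 mulr1 /= expr0n addr0 sqrtr_sqr ger0_norm //.
  by rewrite mulr_ge0.
have Q : normc (x + 1) ^+ 2 = 2 + 2 * complex.Re x.
  case: (x) s1 => a b /= s1; rewrite sqr_sqrtr ?addr_ge0 ?sqr_ge0 // addr0.
  have -> : (a + 1) ^+ 2 + b ^+ 2 = (a ^+ 2 + b ^+ 2) + 1 + 2 * a by ring.
  by rewrite s1; ring.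
have x_lt1 : complex.Re x < 1.
  rewrite lt_neqAle; apply/andP; split.
    apply: contraNneq xn1 => a1; move: s1; rewrite a1 expr1n => /eqP.
    rewrite -subr_eq0 addrAC subrr add0r sqrf_eq0 => b0.
    by rewrite eq_complex /= a1 b0 eqxx.
  by have := sqr_ge0 (complex.Im x); nra.
move=> hy.
have xp : 0 < normc (x + 1).
  rewrite lt_def normc_ge0 andbT; apply/eqP => d0.
  by move: Q; rewrite d0 expr0n /=; lra.
(* After multiplication by |x + 1| the left side is at most 8 Re x and the right side is 4 + 4 Re x,
   so Re x < 1 suffices. *)
rewrite -(ltr_pM2r xp) natrM -!mulrA -expr2 Q; lra.
Qed.

Lemma root_opp1_near1 {R : rcfType} p : (2 <= p)%N ->
  exists2 y : R[i], y ^+ (2 ^ p) = - 1 &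
    (2 ^ p)%N%:R * normc (y - 1) < 2 * normc (y + 1).
Proof.
case: p => [|[|p]] // _; elim: p => [|p [y yM hy]].
  (* For M = 2 the point i gives equality; the first halving makes it strict. *)
  apply: (root_opp1_near1_half 2 'i) => //; first by rewrite sqr_i.
  by rewrite ler_pM2l // -[leLHS]normcN opprB; simpc; rewrite /= sqrrN.
have [|x xM hx] := root_opp1_near1_half _ y _ yM (ltW hy).
  by rewrite expn_gt0.
by exists x; rewrite expnS.
Qed.

Lemma lagrange_norm_gt1 {R : realType} n p (e : nat -> R[i]) c :
  normc c = 1 -> \prod_(j < n.+1) ('X - (e j)%:P) = 'X^(n.+1) - c%:P ->
  n.+1 = (2 ^ p)%N -> (2 <= p)%N ->
  exists k z, [/\ (k < n)%N, normc z <= 1 & 1 < normc (Defs.lagrange e n k z)].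
Proof.
move=> c1 He Dn p2; have [y yN hy] := @root_opp1_near1 R p p2.
rewrite -Dn in yN hy; set w := e n.
have wc : w ^+ n.+1 = c by exact: unity_node_pow He _ _.
have w1 : normc w = 1 by exact: normc_unity c1 wc.
have y1 : normc y = 1 by exact: normc_unity normc_opp1 yN.
(* The node is w y^2 and the test point z = w y, where z^N = - c. *)
have [|k lt_k ek] := unity_node_ex n e c He (w * y ^+ 2).
  by rewrite exprMn wc exprAC yN sqrrN expr1n mulr1.
have d0 : 0 < normc (y - 1).
  rewrite lt_def normc_ge0 normc_eq0 subr_eq0 andbT; apply/eqP => y1'.
  move: yN => /eqP; rewrite y1' expr1n -subr_eq0 opprK -mulr2n.
  by rewrite pnatr_eq0.
have s0 : 0 < normc (y + 1).
  rewrite -(@ltr_pM2l _ 2) // mulr0; apply: le_lt_trans hy.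
  by rewrite mulr_ge0 ?normc_ge0.
have Dk : normc (e k - w) = normc (y - 1) * normc (y + 1).
  rewrite -ek; have -> : w * y ^+ 2 - w = w * ((y - 1) * (y + 1)) by ring.
  by rewrite !normcM w1 mul1r.
have {}lt_k : (k < n)%N.
  move: lt_k; rewrite ltnS leq_eqVlt => /predU1P[kn|//]; move: Dk.
  rewrite kn subrr normc_zero => /esym/eqP.
  by rewrite mulf_eq0 !gt_eqF.
exists k, (w * y); split=> //; first by rewrite normcM w1 y1 mulr1.
have := lagrange_norm_last n e c c1 He k (w * y) lt_k.
have := congr1 (@normc R) (geom_quotientE n.+1 (e k) (w * y)).
rewrite normcM (unity_node_pow n e c He) ?ltnS 1?ltnW // exprMn wc yN.
have -> : normc (c * -1 - c) = 2.
  have -> : c * -1 - c = - (c *+ 2) by ring.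
  by rewrite normcN normcMn c1.
rewrite -/w Dk -ek.
have -> : w * y - w * y ^+ 2 = - (w * y * (y - 1)) by ring.
have -> : w * y - w = w * (y - 1) by ring.
rewrite normcN !normcM w1 y1 !mul1r => HG HL.
have N0 : 0 < n.+1%:R :> R by rewrite ltr0n.
(* With d = |y - 1|, s = |y + 1| and G the modulus of the quotient, N |l_k(z)| d = d s G and d G =
   2; hence |l_k(z)| > 1 amounts to N d < 2 s, which is [hy]. *)
rewrite -(ltr_pM2l N0) mulr1 -(ltr_pM2r d0); apply: lt_le_trans hy _.
rewrite HL; set d := normc (y - 1) in HG *; set s := normc (y + 1).
set G := normc _ in HG *; have -> : d * s * G = (d * G) * s by ring.
by rewrite HG.
Qed.

(** * Leja sequences, suprema on the disk and their sum *)

Lemma boundary_disk_norm {R : realType} (x : R[i]) :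
  Defs.boundary (closed_unit_disk R) x -> normc x <= 1 -> normc x = 1.
Proof.
move=> [_ xint] x1; apply/eqP; rewrite eq_le x1 leNgt /=.
apply/negP => lt_x1; apply: xint; apply/nbhs_ballP.
exists (1 - normc x)%:C; first by rewrite /= ltcR subr_gt0.
move=> y; rewrite -ball_normE /= => xy.
have {}xy : normc (x - y) < 1 - normc x by move: xy; rewrite -ltcR.
rewrite /closed_unit_disk /=; have := ler_distcD x y 0.
rewrite !subr0 (distcC y x); lra.
Qed.

Lemma has_ubound_prod_dist {R : realType} (e : nat -> R[i]) k :
  (forall j, closed_unit_disk R (e j)) ->
  has_ubound [set \prod_(j < k) normc (z - e j) | z in closed_unit_disk R].
Proof.
move=> e1; exists (2 ^+ k) => _ [z z1 <-].
rewrite -[X in 2 ^+ X](card_ord k) -prodr_const; apply: ler_prod => j _.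
by rewrite normc_ge0 normcB_le2 //; exact: e1.
Qed.

Lemma leja_sequence_prefix {R : realType} (e : nat -> R[i]) n :
  leja_sequence (closed_unit_disk R) e -> leja_prefix e n.
Proof.
move=> [e1 e0 eM] k _; split; first exact: e1.
  by move=> ->; apply: boundary_disk_norm e0 _; exact: e1.
move=> z z1; have [->|k_gt0] := posnP k; first by rewrite !big_ord0.
rewrite -eM //; apply: ub_le_sup; first exact: has_ubound_prod_dist.
by exists z.
Qed.

Lemma leja_sequence_binary {R : realType} (e : nat -> R[i]) n p :
  leja_sequence (closed_unit_disk R) e -> n.+1 = (2 ^ p)%N ->
  exists2 c, normc c = 1 & \prod_(j < n.+1) ('X - (e j)%:P) = 'X^(n.+1) - c%:P.
Proof.
move=> he Dn; exists (e 0%N ^+ n.+1); last first.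
  rewrite Dn; apply: (proj2 (@leja_structure R p)).
  exact: leja_sequence_prefix.
have [_ /(_ erefl) e0 _] := leja_sequence_prefix e 1 he 0%N isT.
by rewrite normcX e0 expr1n.
Qed.

Lemma lagrange_disk_sup_le {R : realType} (e : nat -> R[i]) n k B :
  (forall z, normc z <= 1 -> normc (Defs.lagrange e n k z) <= B) ->
  lagrange_disk_sup e n k <= B.
Proof.
move=> hB; apply: ge_sup; last by move=> _ [z z1 <-]; exact: hB.
exists (normc (Defs.lagrange e n k 0)), 0 => //.
by apply: (_ : normc 0 <= 1); rewrite normc_zero.
Qed.

(** [sup] dominates the values only on a set bounded above, which B witnesses. *)
Lemma lagrange_disk_sup_ge {R : realType} (e : nat -> R[i]) n k B z :
  (forall z, normc z <= 1 -> normc (Defs.lagrange e n k z) <= B) ->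
  normc z <= 1 -> normc (Defs.lagrange e n k z) <= lagrange_disk_sup e n k.
Proof.
move=> hB z1; apply: ub_le_sup; last by exists z.
by exists B => _ [y y1 <-]; exact: hB.
Qed.

(** Every supremum is at least |l_k(e_k)| = 1, and [lagrange_norm_gt1] makes one of them larger. *)
Lemma sum_lagrange_disk_sup_gt {R : realType} (e : nat -> R[i]) n p :
  leja_sequence (closed_unit_disk R) e -> n.+1 = (2 ^ p)%N -> (2 <= p)%N ->
  n%:R < \sum_(k < n) lagrange_disk_sup e n k.
Proof.
move=> he Dn p2; have [c c1 He] := leja_sequence_binary e n p he Dn.
have sup_ge k z : (k < n)%N -> normc z <= 1 ->
    normc (Defs.lagrange e n k z) <= lagrange_disk_sup e n k.
  move=> lt_k; apply: lagrange_disk_sup_ge => y y1.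
  exact: lagrange_norm_le c1 He k y lt_k y1.
have sup_ge1 (k : 'I_n) : 1 <= lagrange_disk_sup e n k.
  rewrite -(lagrange_norm_node n e c c1 He k (ltn_ord k)); apply: sup_ge => //.
  by rewrite (unity_node_norm n e c c1 He) // ltnS ltnW.
have [k [z [lt_k z1 hz]]] := lagrange_norm_gt1 n p e c c1 He Dn p2.
have -> : n%:R = \sum_(k < n) 1 :> R by rewrite sumr_const card_ord.
rewrite (bigD1 (Ordinal lt_k)) //= [ltRHS](bigD1 (Ordinal lt_k)) //=.
rewrite ltr_leD //; first exact: lt_le_trans hz (sup_ge k z lt_k z1).
by apply: ler_sum.
Qed.

Lemma sum_lagrange_disk_sup_le {R : realType} (e : nat -> R[i]) n p :
  leja_sequence (closed_unit_disk R) e -> n.+1 = (2 ^ p)%N ->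
  \sum_(k < n) lagrange_disk_sup e n k <= n%:R + 4 * (3 / 2) ^+ p.
Proof.
move=> he Dn; have [c c1 He] := leja_sequence_binary e n p he Dn.
have N0 : 0 < n.+1%:R :> R by rewrite ltr0n.
set w := e n; have w1 : normc w = 1 by exact: unity_node_norm c1 He _ _.
have S : \sum_(k < n) (normc (e k - w))^-1 <= 3 ^+ p.
  have := sum_inv_dist_le p [seq e j | j <- iota 0 n.+1] w w1.
  rewrite !big_map -{1}Dn -[iota 0 n.+1]/(index_iota 0 n.+1) !big_mkord He.
  rewrite Dn -Dn (unity_node_pow n e c He) // => /(_ erefl).
  (* The term at w itself and the indicators are nonnegative and are dropped. *)
  rewrite big_ord_recr /= => S; apply: le_trans S.
  rewrite ler_wpDr ?addr_ge0 ?invr_ge0 ?normc_ge0 ?ler0n //.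
  by apply: ler_sum => k _; rewrite lerDl ler0n.
apply: (@le_trans _ _ (\sum_(k < n) (1 + 4 / n.+1%:R * (normc (e k - w))^-1))).
  apply: ler_sum => k _; apply: lagrange_disk_sup_le => z z1.
  rewrite -mulrA -invfM; exact: lagrange_norm_le c1 He k z (ltn_ord k) z1.
rewrite big_split /= sumr_const card_ord lerD2l -mulr_sumr.
apply: le_trans (ler_wpM2l _ S) _; first by rewrite divr_ge0 // ltW.
by rewrite Dn natrX expr_div_n -mulrA [_^-1 * _]mulrC.
Qed.

Theorem theorem5 (R : realType) (eta : nat -> R[i])
    (eta_leja : leja_sequence (closed_unit_disk R) eta) :
  ((2 ^ p - 1)%N%:R^-1 *
     \sum_(k < 2 ^ p - 1) lagrange_disk_sup eta (2 ^ p - 1) k)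
    @[p --> \oo] --> (1 : R)
  /\
  exists eps : R -> R,
    eps (p%:R^-1) @[p --> \oo] --> (0 : R) /\
    forall p : nat, (2 <= p)%N ->
      (2 ^ p - 1)%N%:R < \sum_(k < 2 ^ p - 1) lagrange_disk_sup eta (2 ^ p - 1) k
      /\
      \sum_(k < 2 ^ p - 1) lagrange_disk_sup eta (2 ^ p - 1) k
        <= (1 + eps (p%:R^-1)) * (2 ^ p - 1)%N%:R.
Proof.
have pow_gt0 p : (0 < 2 ^ p)%N by rewrite expn_gt0.
have Dn p : (2 ^ p - 1).+1 = (2 ^ p)%N by rewrite subn1 prednK.
set S := fun p => \sum_(k < 2 ^ p - 1) lagrange_disk_sup eta (2 ^ p - 1) k.
(* As [eps] takes a real argument, p is recovered from 1/p by inverting and truncating; this holds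
   at p = 0 too, where the inverse of 0 is 0. *)
pose eps (x : R) : R := 8 * (3 / 4) ^+ Num.truncn x^-1.
have epsE p : eps p%:R^-1 = 8 * (3 / 4) ^+ p by rewrite /eps invrK natrK.
have eps0 : eps (p%:R^-1) @[p --> \oo] --> (0 : R).
  rewrite (_ : (fun p => _) = (fun p => 8 * (3 / 4) ^+ p)); last exact/funext.
  rewrite -(mulr0 8); apply: cvgMr; apply: cvg_expr.
  by rewrite ger0_norm; lra.
have lower p : (2 <= p)%N -> (2 ^ p - 1)%N%:R < S p.
  by move=> p2; apply: (sum_lagrange_disk_sup_gt eta _ p).
have upper p : (2 <= p)%N -> S p <= (1 + eps p%:R^-1) * (2 ^ p - 1)%N%:R.
  move=> p2; apply: le_trans (sum_lagrange_disk_sup_le eta _ p eta_leja (Dn p)) _.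
  rewrite [leRHS]mulrDl mul1r lerD2l epsE.
  (* This gives the constant 8: 4 (3/2)^p = 8 (3/4)^p (2^p / 2). *)
  have half : 2 ^+ p / 2 <= (2 ^ p - 1)%N%:R :> R.
    rewrite natrB // natrX ler_pdivrMr //.
    have : (2 : R) <= 2 ^+ p by rewrite -[leLHS]expr1 ler_eXn2l // ?ltr1n // ltnW.
    lra.
  apply: le_trans (ler_wpM2l _ half); last by rewrite mulr_ge0 ?exprn_ge0 //; lra.
  have -> : 3 / 2 = (3 / 4) * 2 :> R by field.
  rewrite exprMn; lra.
split; last by exists eps; split=> // p p2; split; [exact: lower|exact: upper].
apply: (@squeeze_cvgr _ _ _ _ (fun=> 1) (fun p => 1 + eps p%:R^-1)).
- near=> p; have p2 : (2 <= p)%N by near: p; exact: nbhs_infty_ge.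
  have n0 : 0 < (2 ^ p - 1)%N%:R :> R.
    by rewrite ltr0n subn_gt0 -[1%N](expn0 2) ltn_exp2l // ltnW.
  rewrite mulrC ler_pdivlMr // mul1r ler_pdivrMr // upper // andbT.
  exact/ltW/lower.
- exact: cvg_cst.
- by rewrite -[X in _ --> X]addr0; apply: cvgD => //; exact: cvg_cst.
Unshelve. all: by end_near.
Qed.
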